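(* Let $\mathbb{k}$ be a field containing $\mathbb{Q}$, let $\mathcal{T}=(A,B,\varepsilon)$ be a commutative triple over $\mathbb{k}$, and let $M$ be a symmetric $A$-bimodule (equivalently, an $A$-module). Then the map $$\mathrm{Hom}_A(\Omega^1_{\mathcal{T}|\mathbb{k}},M)\longrightarrow\mathrm{Der}_{\mathbb{k}}(\mathcal{T},M),\qquad f\longmapsto f\circ d,$$ is well defined and is an isomorphism of $\mathbb{k}$-vector spaces, where $d:B\otimes A\to\Omega^1_{\mathcal{T}|\mathbb{k}}$ is the map $\alpha\otimes a\mapsto d(\alpha\otimes a)$.
   Context: Conventions: $\mathbb{k}$ is a field containing $\mathbb{Q}$, $\otimes=\otimes_{\mathbb{k}}$, and all $\mathbb{k}$-algebras are associative with unit. Commutative triple: $(A,B,\varepsilon)$ where $A$ and $B$ are commutative $\mathbb{k}$-algebras and $\varepsilon:B\to A$ is a morphism of $\mathbb{k}$-algebras. Secondary derivations: let $\mathcal{T}=(A,B,\varepsilon)$ be a commutative triple and $M$ a symmetric $A$-bimodule, regarded as a symmetric $B\otimes A$-bimodule via $(\alpha\otimes a)\cdot m=a\varepsilon(\alpha)m=m\,a\varepsilon(\alpha)=m\cdot(\alpha\otimes a)$. A secondary derivation of $\mathcal{T}$ with values in $M$ is a $\mathbb{k}$-linear map $D:B\otimes A\to M$ such that for all $a,b\in A$, $\alpha,\beta\in B$: (1) $D((\alpha\otimes a)(\beta\otimes b))=a\varepsilon(\alpha)D(\beta\otimes b)+D(\alpha\otimes a)b\varepsilon(\beta)$, where $(\alpha\otimes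 a)(\beta\otimes b)=\alpha\beta\otimes ab$; and (2) $D(\alpha\otimes 1)+D(\alpha\otimes 1)=D(1\otimes\varepsilon(\alpha))$. The set of these is $\mathrm{Der}_{\mathbb{k}}(\mathcal{T},M)$, a $\mathbb{k}$-vector space under pointwise operations. Secondary Kähler differentials: $\Omega^1_{\mathcal{T}|\mathbb{k}}$ is the left $B\otimes A$-module generated by the $\mathbb{k}$-linear symbols $d(\alpha\otimes a)$ for $\alpha\in B$, $a\in A$ (so $d(x)$ is defined for every $x\in B\otimes A$, $\mathbb{k}$-linearly in $x$), where $B\otimes A$ acts through $A$ by $(\alpha\otimes a)\cdot d(\beta\otimes b)=a\varepsilon(\alpha)\,d(\beta\otimes b)$, i.e. it is the $A$-module on these generators, subject to the relations, for all $a,b\in A$, $\alpha,\beta\in B$, $\lambda,\mu\in\mathbb{k}$: (i) $d(\lambda(\alpha\otimes a)+\mu(\beta\otimes b))=\lambda d(\alpha\otimes a)+\mu d(\beta\otimes b)$; (ii) $d((\alpha\otimes a)(\beta\otimes b))=a\varepsilon(\alpha)d(\beta\otimes b)+b\varepsilon(\beta)d(\alpha\otimes a)$; (iii) $d(\alpha\otimes 1)+d(\alpha\otimes 1)=d(1\otimes\varepsilon(\alpha))$. $\mathrm{Hom}_A$ denotes $A$-linear maps. *)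

(* Defs.v *)
From HB Require Import structures.
From mathcomp Require Import all_boot all_algebra.
From mathcomp Require Import boolp functions.
From mathcomp Require Import finmap.
From mathcomp.multinomials Require Import monalg.

Set Implicit Arguments.
Unset Strict Implicit.
Unset Printing Implicit Defensive.

Import GRing.Theory.

Local Open Scope ring_scope.
Local Open Scope quotient_scope.

Section FreeModule.
Variables (R : pzRingType) (X : choiceType).

(* The lmodType instance that monalg puts on {malg R[X]} requires R to be
   nontrivial; the zero ring is allowed here. *)
Definition freemod : Type := {malg R[X]}.
HB.instance Definition _ := GRing.Zmodule.on freemod.

Implicit Types (c : R) (g : freemod) (x : X).

Definition freemod_scale c g : freemod := [malg x in msupp g => c * mcoeff x g].

Lemma freemod_scaleE c g x : mcoeff x (freemod_scale c g) = c * mcoeff x g.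
Proof. by rewrite mcoeffE; case: msuppP; rewrite ?mulr0. Qed.

Lemma freemod_scaleA c1 c2 g :
  freemod_scale c1 (freemod_scale c2 g) = freemod_scale (c1 * c2) g.
Proof. by apply/malgP => x; rewrite !freemod_scaleE mulrA. Qed.

Lemma freemod_scale1 : left_id 1 freemod_scale.
Proof. by move=> g; apply/malgP => x; rewrite freemod_scaleE mul1r. Qed.

Lemma freemod_scaleDr : right_distributive freemod_scale +%R.
Proof.
move=> c g1 g2; apply/malgP => x.
by rewrite [RHS]mcoeffD !freemod_scaleE [X in _ * X]mcoeffD mulrDr.
Qed.

Lemma freemod_scaleDl g : {morph freemod_scale^~ g : c1 c2 / c1 + c2}.
Proof.
by move=> c1 c2; apply/malgP => x; rewrite [RHS]mcoeffD !freemod_scaleE mulrDl.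
Qed.

HB.instance Definition _ := GRing.Zmodule_isLmodule.Build R freemod
  freemod_scaleA freemod_scale1 freemod_scaleDr freemod_scaleDl.

End FreeModule.

(* Locked, as unfolding it makes rewriting with additivity lemmas diverge. *)
HB.lock Definition free_gen (R : pzRingType) (X : choiceType) (x : X) : freemod R X :=
  mkmalgU x 1.
Canonical free_gen_unlockable := Unlockable free_gen.unlock.
Arguments free_gen R {X} x.

Section FreeModuleTheory.
Variables (R : pzRingType) (X : choiceType).
Implicit Types (c : R) (g : freemod R X) (x : X).

Lemma freemod_coefZ c g x : mcoeff x (c *: g) = c * mcoeff x g.
Proof. exact: freemod_scaleE. Qed.

Lemma freemod_sum g : g = \sum_(x <- msupp g) mcoeff x g *: free_gen R x.
Proof.
rewrite {1}[g]monalgE; apply: eq_bigr => x _; apply/malgP => y.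
by rewrite unlock freemod_coefZ !mcoeffU mulrnAr mulr1.
Qed.

Lemma freemod_ind (P : freemod R X -> Prop) :
  P 0 -> (forall g h, P g -> P h -> P (g + h)) ->
  (forall c x, P (c *: free_gen R x)) -> forall g, P g.
Proof. by move=> P0 PD PZ g; rewrite [g]freemod_sum; elim/big_ind: _. Qed.

Section Lift.
Variables (V : lmodType R) (f : X -> V).

Definition freemod_lift g : V := \sum_(x <- msupp g) mcoeff x g *: f x.

Lemma freemod_liftEw (d : {fset X}) g : (msupp g `<=` d)%fset ->
  freemod_lift g = \sum_(x <- d) mcoeff x g *: f x.
Proof.
move=> gd; rewrite /freemod_lift (big_fset_incl _ gd) //= => x _ xg.
by rewrite mcoeff_outdom ?scale0r.
Qed.

Lemma freemod_lift_linear : linear freemod_lift.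
Proof.
move=> c g h; pose d := (msupp g `|` msupp h `|` msupp (c *: g + h)%R)%fset.
have gd : (msupp g `<=` d)%fset by rewrite /d -fsetUA fsubsetUl.
have hd : (msupp h `<=` d)%fset by rewrite /d fsetUAC fsubsetUr.
have ghd : (msupp (c *: g + h)%R `<=` d)%fset by rewrite /d fsubsetUr.
rewrite (freemod_liftEw gd) (freemod_liftEw hd) (freemod_liftEw ghd).
rewrite scaler_sumr -big_split /=; apply: eq_bigr => x _.
by rewrite mcoeffD freemod_coefZ scalerDl scalerA.
Qed.

HB.instance Definition _ :=
  GRing.isLinear.Build R (freemod R X) V *:%R freemod_lift freemod_lift_linear.

Lemma freemod_lift_gen x : freemod_lift (free_gen R x) = f x.
Proof.
rewrite unlock (@freemod_liftEw [fset x]%fset) ?msuppU_le // big_seq_fset1.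
by rewrite mcoeffUU scale1r.
Qed.

End Lift.

End FreeModuleTheory.

Section Quotient.
Variables (R : pzRingType) (V : lmodType R) (G : V -> Prop).

Inductive submod_span : V -> Prop :=
| span_gen v of G v : submod_span v
| span0 : submod_span 0
| spanD u v of submod_span u & submod_span v : submod_span (u + v)
| spanZ c v of submod_span v : submod_span (c *: v).

Definition span_pred : {pred V} := fun v => `[< submod_span v >].

Lemma span_zmod : zmod_closed span_pred.
Proof.
split=> [|u v /asboolP hu /asboolP hv]; apply/asboolP; first exact: span0.
by apply: spanD => //; rewrite -scaleN1r; apply: spanZ.
Qed.

HB.instance Definition _ := GRing.isZmodClosed.Build V span_pred span_zmod.

(* V modulo the submodule generated by the elements satisfying G. *)
Definition lmod_quot : Type := Quotient.quot span_pred.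
HB.instance Definition _ := GRing.Zmodule.on lmod_quot.

Definition quot_class (v : V) : lmod_quot := \pi_(Quotient.quot span_pred) v.

Lemma quot_classP u v : quot_class u = quot_class v <-> submod_span (u - v).
Proof.
split=> [/eqP|h]; first by rewrite -Quotient.idealrBE => /asboolP.
by apply/eqP; rewrite -Quotient.idealrBE; apply/asboolP.
Qed.

Lemma quot_classK (q : lmod_quot) : quot_class (repr q) = q.
Proof. exact: reprK. Qed.

Lemma quot_class_eq u v : G (u - v) -> quot_class u = quot_class v.
Proof. by move=> Guv; apply/quot_classP/span_gen. Qed.

Lemma quot_classD : {morph quot_class : u v / u + v}.
Proof. exact: raddfD. Qed.

Definition quot_scale (c : R) (q : lmod_quot) : lmod_quot := quot_class (c *: repr q).

Lemma quot_scale_class c v : quot_scale c (quot_class v) = quot_class (c *: v).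
Proof. by apply/quot_classP; rewrite -scalerBr; apply/spanZ/quot_classP/quot_classK. Qed.

Lemma quot_scaleA c1 c2 q :
  quot_scale c1 (quot_scale c2 q) = quot_scale (c1 * c2) q.
Proof. by rewrite -[q]quot_classK !quot_scale_class scalerA. Qed.

Lemma quot_scale1 : left_id 1 quot_scale.
Proof. by move=> q; rewrite -[q in LHS]quot_classK quot_scale_class scale1r quot_classK. Qed.

Lemma quot_scaleDr : right_distributive quot_scale +%R.
Proof.
move=> c p q; rewrite -[p]quot_classK -[q]quot_classK -quot_classD !quot_scale_class.
by rewrite scalerDr quot_classD.
Qed.

Lemma quot_scaleDl q : {morph quot_scale^~ q : c1 c2 / c1 + c2}.
Proof.
by move=> c1 c2; rewrite -[q]quot_classK !quot_scale_class scalerDl quot_classD.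
Qed.

HB.instance Definition _ := GRing.Zmodule_isLmodule.Build R lmod_quot
  quot_scaleA quot_scale1 quot_scaleDr quot_scaleDl.

Lemma quot_classZ c v : quot_class (c *: v) = c *: quot_class v.
Proof. exact/esym/quot_scale_class. Qed.

Lemma quot_class_linear : linear quot_class.
Proof. by move=> c u v; rewrite quot_classD quot_classZ. Qed.

HB.instance Definition _ := GRing.isLinear.Build R V lmod_quot *:%R quot_class quot_class_linear.

Section Lift.
Variables (W : lmodType R) (f : {linear V -> W}).
Hypothesis fG : forall v, G v -> f v = 0.

Definition quot_lift (q : lmod_quot) : W := f (repr q).

Lemma quot_lift_class v : quot_lift (quot_class v) = f v.
Proof.
have f0 u : submod_span u -> f u = 0.
  elim=> {u}; first exact: fG.
  - exact: raddf0.
  - by move=> u w _ fu _ fw; rewrite raddfD /= fu fw addr0.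
  - by move=> c u _ fu; rewrite linearZ /= fu scaler0.
by apply/eqP; rewrite -subr_eq0 -raddfB; apply/eqP/f0/quot_classP/quot_classK.
Qed.

Lemma quot_lift_linear : linear quot_lift.
Proof.
move=> c p q; rewrite -[p]quot_classK -[q]quot_classK -linearP.
by rewrite !quot_lift_class linearP.
Qed.

End Lift.

End Quotient.

Section Tensor.
Variables (K : pzRingType) (U V : lmodType K).

Definition tgen (u : U) (v : V) : freemod K (U * V)%type := free_gen K (u, v).

Variant tensor_rel : freemod K (U * V)%type -> Prop :=
| tensor_relDl u1 u2 v :
    tensor_rel (tgen (u1 + u2) v - (tgen u1 v + tgen u2 v))
| tensor_relDr u v1 v2 :
    tensor_rel (tgen u (v1 + v2) - (tgen u v1 + tgen u v2))
| tensor_relZl c u v : tensor_rel (tgen (c *: u) v - c *: tgen u v)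
| tensor_relZr c u v : tensor_rel (tgen u (c *: v) - c *: tgen u v).

Definition tensor : Type := lmod_quot tensor_rel.
HB.instance Definition _ := GRing.Lmodule.on tensor.

Definition tens (u : U) (v : V) : tensor := quot_class tensor_rel (tgen u v).

Lemma tensDl u1 u2 v : tens (u1 + u2) v = tens u1 v + tens u2 v.
Proof.
by rewrite /tens -quot_classD; apply/quot_class_eq/tensor_relDl.
Qed.

Lemma tensDr u v1 v2 : tens u (v1 + v2) = tens u v1 + tens u v2.
Proof.
by rewrite /tens -quot_classD; apply/quot_class_eq/tensor_relDr.
Qed.

Lemma tensZl c u v : tens (c *: u) v = c *: tens u v.
Proof.
by rewrite /tens -quot_classZ; apply/quot_class_eq/tensor_relZl.
Qed.

Lemma tensZr c u v : tens u (c *: v) = c *: tens u v.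
Proof.
by rewrite /tens -quot_classZ; apply/quot_class_eq/tensor_relZr.
Qed.

Lemma tensor_ind (P : tensor -> Prop) :
  (forall x y, P x -> P y -> P (x + y)) -> (forall u v, P (tens u v)) ->
  forall x, P x.
Proof.
move=> PD Pt x; rewrite -[x]quot_classK; elim/freemod_ind: (repr x).
- have := Pt 0 0; congr P; apply/eqP; rewrite -[X in tens X _](scale0r 0).
  by rewrite tensZl scale0r raddf0.
- by move=> g h Pg Ph; rewrite raddfD; apply: PD.
- by move=> c [u v]; rewrite linearZ /= -/(tens u v) -tensZl.
Qed.

Section Lift.
Variables (W : lmodType K) (f : U -> V -> W).
Hypotheses (fl : forall v, linear (f^~ v)) (fr : forall u, linear (f u)).

Definition tensor_lift (x : tensor) : W :=
  quot_lift (freemod_lift (fun p => f p.1 p.2)) x.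

Fact tensor_lift_rel g :
  tensor_rel g -> freemod_lift (fun p => f p.1 p.2) g = 0.
Proof.
have f0l v : f 0 v = 0 by have := fl v (-1) 0 0; rewrite scaler0 addr0 scaleN1r addNr.
have f0r u : f u 0 = 0 by have := fr u (-1) 0 0; rewrite scaler0 addr0 scaleN1r addNr.
pose L : {linear freemod K (U * V)%type -> W} :=
  freemod_lift (fun p => f p.1 p.2).
rewrite -/(L g).
have Lt u v : L (tgen u v) = f u v by exact: freemod_lift_gen.
have LB x y : L (x - y) = L x - L y by exact: raddfB.
have LD x y : L (x + y) = L x + L y by exact: raddfD.
have LZ c x : L (c *: x) = c *: L x by exact: linearZZ.
case=> [u1 u2 v|u v1 v2|c u v|c u v]; rewrite LB ?LD ?LZ !Lt.
- by have /= := fl v 1 u1 u2; rewrite !scale1r => ->; rewrite subrr.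
- by have /= := fr u 1 v1 v2; rewrite !scale1r => ->; rewrite subrr.
- by have /= := fl v c u 0; rewrite !addr0 f0l addr0 => ->; rewrite subrr.
- by have /= := fr u c v 0; rewrite !addr0 f0r addr0 => ->; rewrite subrr.
Qed.

Lemma tensor_lift_tens u v : tensor_lift (tens u v) = f u v.
Proof.
rewrite /tensor_lift /tens quot_lift_class; first exact: freemod_lift_gen.
exact: tensor_lift_rel.
Qed.

Lemma tensor_lift_linear : linear tensor_lift.
Proof. exact/quot_lift_linear/tensor_lift_rel. Qed.

End Lift.

End Tensor.

(* A commutative algebra is given by its structure morphism from the base ring:
   comAlgType would exclude the zero algebra. *)
Record comAlg (k : pzRingType) := ComAlg {
  alg_ring :> comPzRingType;
  alg_map : {rmorphism k -> alg_ring}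
}.

Definition comAlg_of (k : comPzRingType) (A : comAlgType k) : comAlg k :=
  @ComAlg k A (in_alg A).

(* An A-module seen as a k-module along the structure morphism k -> A. *)
Section Restriction.
Variables (k : pzRingType) (A : comAlg k) (M : lmodType A).

Definition restr : Type := M.
HB.instance Definition _ := GRing.Zmodule.on restr.

Definition restr_scale (c : k) (m : restr) : restr := alg_map A c *: (m : M).

Fact restr_scaleA c1 c2 m :
  restr_scale c1 (restr_scale c2 m) = restr_scale (c1 * c2) m.
Proof. by rewrite /restr_scale scalerA rmorphM. Qed.

Fact restr_scale1 : left_id 1 restr_scale.
Proof. by move=> m; rewrite /restr_scale rmorph1 scale1r. Qed.

Fact restr_scaleDr : right_distributive restr_scale +%R.
Proof. by move=> c m n; rewrite /restr_scale scalerDr. Qed.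

Fact restr_scaleDl m : {morph restr_scale^~ m : c1 c2 / c1 + c2}.
Proof. by move=> c1 c2; rewrite /restr_scale rmorphD scalerDl. Qed.

HB.instance Definition _ := GRing.Zmodule_isLmodule.Build k restr
  restr_scaleA restr_scale1 restr_scaleDr restr_scaleDl.

End Restriction.

Definition alg_mod (k : pzRingType) (A : comAlg k) : Type :=
  restr [the lmodType A of A^o].
HB.instance Definition _ (k : pzRingType) (A : comAlg k) :=
  GRing.Lmodule.on (alg_mod A).

Section TensorAlgebra.
Variables (k : pzRingType) (B A : comAlg k).

Definition talg : Type := tensor (alg_mod B) (alg_mod A).
HB.instance Definition _ := GRing.Lmodule.on talg.

Definition tpure (beta : B) (a : A) : talg :=
  tens (beta : alg_mod B) (a : alg_mod A).

Lemma tpureDl b1 b2 a : tpure (b1 + b2) a = tpure b1 a + tpure b2 a.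
Proof. exact: tensDl. Qed.

Lemma tpureDr b a1 a2 : tpure b (a1 + a2) = tpure b a1 + tpure b a2.
Proof. exact: tensDr. Qed.

Lemma tpureZl c b a : tpure (alg_map B c * b) a = c *: tpure b a.
Proof. exact: tensZl. Qed.

Lemma tpureZr c b a : tpure b (alg_map A c * a) = c *: tpure b a.
Proof. exact: tensZr. Qed.

Lemma talg_ind (P : talg -> Prop) :
  (forall x y, P x -> P y -> P (x + y)) -> (forall b a, P (tpure b a)) ->
  forall x, P x.
Proof. exact: tensor_ind. Qed.

Definition talg_mull (b : alg_mod B) (a : alg_mod A) : talg -> talg :=
  tensor_lift (fun (b' : alg_mod B) (a' : alg_mod A) =>
    tpure ((b : B) * (b' : B)) ((a : A) * (a' : A))).

Fact talg_mull_linl b a a' :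
  linear (fun b' : alg_mod B => tpure ((b : B) * (b' : B)) (a * a' : A)).
Proof.
move=> c u v; rewrite -tpureZl -tpureDl; congr tpure.
by rewrite [LHS]mulrDr mulrCA.
Qed.

Fact talg_mull_linr (b b' : B) (a : A) :
  linear (fun a' : alg_mod A => tpure (b * b') ((a : A) * (a' : A))).
Proof.
move=> c u v; rewrite -tpureZr -tpureDr; congr tpure.
by rewrite [LHS]mulrDr mulrCA.
Qed.

Lemma talg_mull_pure (b b' : B) (a a' : A) :
  talg_mull b a (tpure b' a') = tpure (b * b') (a * a').
Proof.
apply: tensor_lift_tens => [a1|b1]; [exact: talg_mull_linl|exact: talg_mull_linr].
Qed.

Lemma talg_mull_linear b a : linear (talg_mull b a).
Proof.
apply: tensor_lift_linear => [a1|b1]; [exact: talg_mull_linl|exact: talg_mull_linr].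
Qed.

Fact talg_mull_funl a : linear (talg_mull^~ a : alg_mod B -> (talg -> talg)).
Proof.
move=> c u v; apply/funext; elim/talg_ind => [x y hx hy|b' a'].
  have D w : {morph talg_mull w a : x y / x + y}.
    by move=> p q; have := talg_mull_linear w a 1 p q; rewrite !scale1r.
  rewrite D hx hy [RHS]/(c *: talg_mull u a _ + talg_mull v a _) !D.
  by rewrite scalerDr addrACA.
rewrite talg_mull_pure [RHS]/(c *: talg_mull u a _ + talg_mull v a _).
rewrite !talg_mull_pure.
transitivity (tpure (alg_map B c * ((u : B) * b') + (v : B) * b') (a * a')).
  by congr tpure; rewrite mulrA -mulrDl.
by rewrite tpureDl tpureZl.
Qed.

Fact talg_mull_funr b : linear (talg_mull b : alg_mod A -> (talg -> talg)).
Proof.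
move=> c u v; apply/funext; elim/talg_ind => [x y hx hy|b' a'].
  have D w : {morph talg_mull b w : x y / x + y}.
    by move=> p q; have := talg_mull_linear b w 1 p q; rewrite !scale1r.
  rewrite D hx hy [RHS]/(c *: talg_mull b u _ + talg_mull b v _) !D.
  by rewrite scalerDr addrACA.
rewrite talg_mull_pure [RHS]/(c *: talg_mull b u _ + talg_mull b v _).
rewrite !talg_mull_pure.
transitivity (tpure (b * b') (alg_map A c * ((u : A) * a') + (v : A) * a')).
  by congr tpure; rewrite mulrA -mulrDl.
by rewrite tpureDr tpureZr.
Qed.

Definition talg_mul : talg -> talg -> talg := tensor_lift talg_mull.

Lemma talg_mul_pure b a b' a' :
  talg_mul (tpure b a) (tpure b' a') = tpure (b * b') (a * a').
Proof.
rewrite /talg_mul tensor_lift_tens; first exact: talg_mull_pure.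
- exact: talg_mull_funl.
- exact: talg_mull_funr.
Qed.

Fact talg_mulDl : left_distributive talg_mul +%R.
Proof.
move=> x y z; have := tensor_lift_linear talg_mull_funl talg_mull_funr 1 x y.
by rewrite !scale1r => /(congr1 (@^~ z)).
Qed.

Fact talg_mulC : commutative talg_mul.
Proof.
have Dr b a : {morph talg_mul (tpure b a) : x y / x + y}.
  move=> x y; rewrite /talg_mul !tensor_lift_tens; last 2 first.
  - exact: talg_mull_funl.
  - exact: talg_mull_funr.
  by have := talg_mull_linear b a 1 x y; rewrite !scale1r.
elim/talg_ind => [x y hx hy z|b a].
  rewrite talg_mulDl hx hy; elim/talg_ind: z => [z t hz ht|b a].
    by rewrite !talg_mulDl -hz -ht addrACA.
  by rewrite Dr.
elim/talg_ind => [x y hx hy|b' a']; first by rewrite Dr talg_mulDl hx hy.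
by rewrite !talg_mul_pure mulrC [in X in tpure _ X]mulrC.
Qed.

Fact talg_mulDr : right_distributive talg_mul +%R.
Proof. by move=> x y z; rewrite talg_mulC talg_mulDl !(talg_mulC x). Qed.

Fact talg_mulA : associative talg_mul.
Proof.
elim/talg_ind => [x y hx hy z t|b a]; first by rewrite !talg_mulDl hx hy.
elim/talg_ind => [x y hx hy t|b' a'].
  by rewrite talg_mulDl !talg_mulDr talg_mulDl hx hy.
elim/talg_ind => [x y hx hy|b'' a'']; first by rewrite !talg_mulDr hx hy.
by rewrite !talg_mul_pure !mulrA.
Qed.

Fact talg_mul1 : left_id (tpure 1 1) talg_mul.
Proof.
elim/talg_ind => [x y hx hy|b a]; first by rewrite talg_mulDr hx hy.
by rewrite talg_mul_pure !mul1r.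
Qed.

HB.instance Definition _ := GRing.Zmodule_isComPzRing.Build talg
  talg_mulA talg_mulC talg_mul1 talg_mulDl.

Lemma tpureM b a b' a' : tpure b a * tpure b' a' = tpure (b * b') (a * a').
Proof. exact: talg_mul_pure. Qed.

Lemma talg_scalerAl c (x y : talg) : c *: (x * y) = (c *: x) * y.
Proof.
elim/talg_ind: x => [x1 x2 h1 h2|b a].
  by rewrite mulrDl !scalerDr mulrDl h1 h2.
elim/talg_ind: y => [y1 y2 h1 h2|b' a'].
  by rewrite !mulrDr scalerDr h1 h2.
by rewrite tpureM -!tpureZl tpureM mulrA.
Qed.

End TensorAlgebra.

Record comTriple (k : fieldType) := ComTriple {
  tripA : comAlg k;
  tripB : comAlg k;
  trip_eps : {rmorphism tripB -> tripA};
  trip_epsE : forall c : k, trip_eps (alg_map tripB c) = alg_map tripA c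
}.

(* The A-linear maps U -> V, with the k-vector space structure inherited
   from V through k -> A. *)
Section LinearMaps.
Variables (k : fieldType) (A : comAlg k) (U V : lmodType A).

Definition khom : Type := {linear U -> V}.
HB.instance Definition _ := gen_eqMixin khom.
HB.instance Definition _ := gen_choiceMixin khom.

Implicit Types f g h : khom.

Lemma khomP f g : f =1 g -> f = g.
Proof.
move: f g => [f [[fD] [fZ]]] [g [[gD] [gZ]]] /= /funext fg; subst g.
by rewrite (Prop_irrelevance fD gD) (Prop_irrelevance fZ gZ).
Qed.

Definition khom_add f g : khom := f \+ g.
Definition khom_opp f : khom := \- f.
Definition khom_zero : khom := \0.
Definition khom_scale (c : k) f : khom := alg_map A c \*: f.

Fact khom_addA : associative khom_add.
Proof. by move=> f g h; apply: khomP => x /=; rewrite addrA. Qed.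

Fact khom_addC : commutative khom_add.
Proof. by move=> f g; apply: khomP => x /=; rewrite addrC. Qed.

Fact khom_add0 : left_id khom_zero khom_add.
Proof. by move=> f; apply: khomP => x /=; rewrite add0r. Qed.

Fact khom_addN : left_inverse khom_zero khom_opp khom_add.
Proof. by move=> f; apply: khomP => x /=; rewrite addNr. Qed.

HB.instance Definition _ := GRing.isZmodule.Build khom
  khom_addA khom_addC khom_add0 khom_addN.

Fact khom_scaleA c1 c2 f :
  khom_scale c1 (khom_scale c2 f) = khom_scale (c1 * c2) f.
Proof. by apply: khomP => x /=; rewrite scalerA rmorphM. Qed.

Fact khom_scale1 : left_id 1 khom_scale.
Proof. by move=> f; apply: khomP => x /=; rewrite rmorph1 scale1r. Qed.

Fact khom_scaleDr : right_distributive khom_scale +%R.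
Proof. by move=> c f g; apply: khomP => x /=; rewrite scalerDr. Qed.

Fact khom_scaleDl f : {morph khom_scale^~ f : c1 c2 / c1 + c2}.
Proof. by move=> c1 c2; apply: khomP => x /=; rewrite rmorphD scalerDl. Qed.

HB.instance Definition _ := GRing.Zmodule_isLmodule.Build k khom
  khom_scaleA khom_scale1 khom_scaleDr khom_scaleDl.

End LinearMaps.

Section Secondary.
Variables (k : fieldType) (T : comTriple k).
Local Notation A := (tripA T).
Local Notation B := (tripB T).
Local Notation eps := (trip_eps T).

Section Derivations.
Variable M : lmodType A.

(* A symmetric A-bimodule is an A-module with right action m b := b *: m. *)
Record is_secder (D : talg B A -> M) : Prop := IsSecder {
  secder_linear : linear (D : talg B A -> restr M);
  secder_leibniz (a b : A) (alpha beta : B) :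
    D (tpure alpha a * tpure beta b) =
      (a * eps alpha) *: D (tpure beta b) + (b * eps beta) *: D (tpure alpha a);
  secder_double (alpha : B) :
    D (tpure alpha 1) + D (tpure alpha 1) = D (tpure 1 (eps alpha))
}.

Definition secder_pred : {pred (talg B A -> restr M)} :=
  fun D => `[< is_secder D >].

Fact secder_submod : subsemimod_closed secder_pred.
Proof.
split; first split.
- apply/asboolP; split=> [c x y|a b alpha beta|alpha].
  + by rewrite scaler0 addr0.
  + by rewrite !scaler0 addr0.
  + by rewrite addr0.
- move=> D E /asboolP[Dl DM D2] /asboolP[El EM E2].
  apply/asboolP; split=> [c x y|a b alpha beta|alpha].
  + change (D (c *: x + y) + E (c *: x + y) =
      c *: (D x + E x : restr M) + (D y + E y)).
    by rewrite Dl El scalerDr addrACA.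
  + change (D (tpure alpha a * tpure beta b) + E (tpure alpha a * tpure beta b)
      = (a * eps alpha) *: ((D (tpure beta b) : M) + E (tpure beta b))
      + (b * eps beta) *: ((D (tpure alpha a) : M) + E (tpure alpha a)) :> M).
    by rewrite DM EM !scalerDr addrACA.
  + change ((D (tpure alpha 1) : M) + E (tpure alpha 1) +
      (D (tpure alpha 1) + E (tpure alpha 1)) =
      D (tpure 1 (eps alpha)) + E (tpure 1 (eps alpha))).
    by rewrite addrACA D2 E2.
- move=> c D /asboolP[Dl DM D2].
  apply/asboolP; split=> [e x y|a b alpha beta|alpha].
  + change (c *: D (e *: x + y) = e *: (c *: D x : restr M) + c *: D y).
    by rewrite Dl scalerDr !scalerA mulrC.
  + change (alg_map A c *: (D (tpure alpha a * tpure beta b) : M)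
      = (a * eps alpha) *: (alg_map A c *: (D (tpure beta b) : M))
      + (b * eps beta) *: (alg_map A c *: (D (tpure alpha a) : M))).
    rewrite DM scalerDr !scalerA.
    by rewrite (mulrC (alg_map A c)) [in X in _ + X](mulrC (alg_map A c)).
  + change (alg_map A c *: (D (tpure alpha 1) : M) +
      alg_map A c *: (D (tpure alpha 1) : M) =
      alg_map A c *: (D (tpure 1 (eps alpha)) : M)).
    by rewrite -scalerDr D2.
Qed.

HB.instance Definition _ :=
  GRing.isSubmodClosed.Build k (talg B A -> restr M) secder_pred secder_submod.

Record secder := Secder {
  secder_val :> talg B A -> restr M;
  _ : secder_pred secder_val
}.

HB.instance Definition _ := [isSub for secder_val].
HB.instance Definition _ := [Choice of secder by <:].
HB.instance Definition _ := [SubChoice_isSubLmodule of secder by <:].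

End Derivations.

Definition omega_gen (x : talg B A) : freemod A (talg B A) := free_gen A x.

Variant omega_rel : freemod A (talg B A) -> Prop :=
| omega_rel_linear (c e : k) (x y : talg B A) :
    omega_rel (omega_gen (c *: x + e *: y) -
      (alg_map A c *: omega_gen x + alg_map A e *: omega_gen y))
| omega_rel_leibniz (a b : A) (alpha beta : B) :
    omega_rel (omega_gen (tpure alpha a * tpure beta b) -
      ((a * eps alpha) *: omega_gen (tpure beta b) +
       (b * eps beta) *: omega_gen (tpure alpha a)))
| omega_rel_double (alpha : B) :
    omega_rel (omega_gen (tpure alpha 1) + omega_gen (tpure alpha 1) -
      omega_gen (tpure 1 (eps alpha))).

Definition omega : Type := lmod_quot omega_rel.
HB.instance Definition _ := GRing.Lmodule.on omega.

Definition omega_d (x : talg B A) : omega := quot_class omega_rel (omega_gen x).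

Lemma omega_d_linear (c e : k) x y :
  omega_d (c *: x + e *: y) = alg_map A c *: omega_d x + alg_map A e *: omega_d y.
Proof.
have := quot_class_eq (omega_rel_linear c e x y).
by rewrite quot_classD !quot_classZ.
Qed.

Lemma omega_d_leibniz (a b : A) (alpha beta : B) :
  omega_d (tpure alpha a * tpure beta b) =
    (a * eps alpha) *: omega_d (tpure beta b) +
    (b * eps beta) *: omega_d (tpure alpha a).
Proof.
have := quot_class_eq (omega_rel_leibniz a b alpha beta).
by rewrite quot_classD !quot_classZ.
Qed.

Lemma omega_d_double (alpha : B) :
  omega_d (tpure alpha 1) + omega_d (tpure alpha 1) =
  omega_d (tpure 1 (eps alpha)).
Proof.
rewrite -quot_classD; exact: quot_class_eq (omega_rel_double alpha).
Qed.

End Secondary.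

(* Main.v *)
Require Import Defs.
From HB Require Import structures.
From mathcomp Require Import all_boot all_algebra.
From mathcomp Require Import boolp.

Set Implicit Arguments.
Unset Strict Implicit.
Unset Printing Implicit Defensive.

Import GRing.Theory.

Local Open Scope ring_scope.

Section UniversalProperty.
Variables (k : fieldType) (T : comTriple k) (M : lmodType (tripA T)).

(** [omega T] is a free [A]-module on symbols d(x) modulo exactly the axioms of a secondary
    derivation, so [omega_d] is the universal one. Composing it with an [A]-linear map gives a
    derivation. Conversely, the [A]-linear extension of a derivation [D] to the free module kills
    the relators ([freemod_lift_omega_rel]) and descends to [omega_lift D]. This is inverse to
    composition because the d(x) generate [omega T] ([omega_hom_ext]). *)

Lemma is_secder_comp (f : khom (omega T) M) : is_secder (fun x => f (omega_d x)).
Proof.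
split=> [c x y|a b alpha beta|alpha].
(* [linear] carries a single scalar, so the second coefficient of the relation is taken to be 1. *)
- have := omega_d_linear c 1 x y; rewrite rmorph1 !scale1r => ->.
  by rewrite raddfD /= linearZZ.
- by rewrite omega_d_leibniz raddfD /= !linearZZ.
- by rewrite -omega_d_double raddfD.
Qed.

Definition secder_comp (f : khom (omega T) M) : secder M :=
  Secder (introT (asboolP _) (is_secder_comp f)).

(** On both sides [k] acts on values in [M] through [alg_map], so the underlying functions agree by
    computation. *)
Lemma secder_comp_linear : linear secder_comp.
Proof. by move=> c f g; apply: val_inj. Qed.

HB.instance Definition _ :=
  GRing.isLinear.Build k (khom (omega T) M) (secder M) *:%R
    secder_comp secder_comp_linear.

Lemma secderP (D : secder M) : is_secder D.
Proof. by apply/asboolP; exact: valP D. Qed.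

(** Each kind of relator is sent to the defect of one axiom of [D], which vanishes. This makes
    [omega_lift] independent of representatives. *)
Lemma freemod_lift_omega_rel (D : secder M) v :
  omega_rel v -> freemod_lift (D : talg _ _ -> M) v = 0.
Proof.
have [Dlin Dleib Ddbl] := secderP D.
pose L : {linear freemod (tripA T) (talg (tripB T) (tripA T)) -> M} :=
  freemod_lift (D : talg _ _ -> M).
rewrite -/(L v).
have Lg x : L (omega_gen x) = D x by exact: freemod_lift_gen.
have LB x y : L (x - y) = L x - L y by exact: raddfB.
have LD x y : L (x + y) = L x + L y by exact: raddfD.
have LZ c x : L (c *: x) = c *: L x by exact: linearZZ.
have D0 : D 0 = 0 :> M.
  (* The scalar -1 turns linearity at 0 into D 0 = - D 0 + D 0. *)
  by have := Dlin (-1) 0 0; rewrite scaler0 addr0 scaleN1r addNr.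
have DZ c x : D (c *: x) = alg_map (tripA T) c *: (D x : M) :> M.
  by have := Dlin c x 0; rewrite D0 !addr0.
case=> [c e x y|a b alpha beta|alpha]; rewrite LB !LD ?LZ !Lg.
- by rewrite Dlin DZ subrr.
- by rewrite Dleib subrr.
- by rewrite Ddbl subrr.
Qed.

Definition omega_lift (D : secder M) : omega T -> M :=
  quot_lift (freemod_lift (D : talg _ _ -> M)).

Lemma omega_lift_linear D : linear (omega_lift D).
Proof. exact/quot_lift_linear/freemod_lift_omega_rel. Qed.

HB.instance Definition _ D :=
  GRing.isLinear.Build (tripA T) (omega T) M *:%R
    (omega_lift D) (omega_lift_linear D).

Lemma omega_lift_d D x : omega_lift D (omega_d x) = D x.
Proof.
rewrite /omega_lift quot_lift_class; first exact: freemod_lift_gen.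
exact: freemod_lift_omega_rel.
Qed.

(** Every class lifts to the free module, whose elements are [A]-combinations of generators; this
    yields injectivity. *)
Lemma omega_hom_ext (f g : khom (omega T) M) :
  (forall x, f (omega_d x) = g (omega_d x)) -> f = g.
Proof.
move=> fg; apply: khomP => q; rewrite -[q]quot_classK.
elim/freemod_ind: (repr q) => [|u v fu fv|c x].
- by rewrite !raddf0.
- by rewrite quot_classD !raddfD /= fu fv.
- by rewrite quot_classZ !linearZZ fg.
Qed.

Lemma secder_comp_bij : bijective secder_comp.
Proof.
exists (fun D => omega_lift D : khom (omega T) M) => [f|D].
- by apply: omega_hom_ext => x; exact: omega_lift_d.
- by apply: val_inj; apply/funext => x; exact: omega_lift_d.
Qed.

End UniversalProperty.

Theorem proposition4p3 (k : fieldType) (k_containsQ : [pchar k] =i pred0)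
    (T : comTriple k) (M : lmodType (tripA T)) :
  exists Phi : {linear khom (omega T) M -> secder M},
    (forall (f : khom (omega T) M) (x : talg (tripB T) (tripA T)),
      Phi f x = f (omega_d x)) /\
    bijective Phi.
Proof. by exists (@secder_comp k T M); split=> //; exact: secder_comp_bij. Qed.
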